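(* Let $n$ be an integer with $1\le n<\infty$, and let $A=\mathrm{IDD}(K^1_n,1,0)$ be the complex algebra with basis $e_1,\ldots,e_n$ and bilinear multiplication $e_i\diamond e_j=i\,e_{i+j-1}$ if $i+j\le n+1$, and $e_i\diamond e_j=0$ otherwise. Then the space of derivations of $A$ is $$\mathfrak{Der}(A)=\langle\varphi\rangle,\qquad \varphi(e_i)=(i-1)e_i\quad(1\le i\le n).$$
   Context: A derivation of an algebra $(A,\diamond)$ is a linear map $D:A\to A$ with $D(a\diamond b)=D(a)\diamond b+a\diamond D(b)$ for all $a,b\in A$. $\langle S\rangle$ denotes the linear span of $S$ over $\mathbb C$. *)

(* Defs.v *)
From HB Require Import structures.
From mathcomp Require Import all_boot all_order all_algebra.
From mathcomp Require Import complex.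
From mathcomp Require Import boolp classical_sets reals.

Set Implicit Arguments.
Unset Strict Implicit.
Unset Printing Implicit Defensive.

Import GRing.Theory.
Local Open Scope ring_scope.

Section Derivations.
Variables (K : fieldType) (A : vectType K) (mul : A -> A -> A).

Definition derivation (D : 'End(A)) : Prop :=
  forall a b : A, D (mul a b) = mul (D a) b + mul a (D b).

Definition Der : set 'End(A) := [set D | derivation D]%classic.

End Derivations.

Section IDD.
Variables (R : realType) (n : nat).

(* The algebra IDD(K^1_n, 1, 0) is the space of coordinate rows, with the
   product [idd_mul]. *)
Local Notation IDD := 'rV[R[i]]_n.

(* Basis vectors are numbered from 1: [idd_e k] is e_k for 1 <= k <= n, and 0
   for the other k. The coordinate of [a : IDD] along e_{i+1} is [a 0 i]. *)
Definition idd_e (k : nat) : IDD := \row_(i < n) (i.+1 == k)%:R.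

Definition idd_mul_basis (i j : nat) : IDD :=
  if (i + j <= n.+1)%N then i%:R *: idd_e (i + j - 1) else 0.

Definition idd_mul (a b : IDD) : IDD :=
  \sum_(i < n) \sum_(j < n) (a 0 i * b 0 j) *: idd_mul_basis i.+1 j.+1.

Definition idd_phi_fun (a : IDD) : IDD :=
  \sum_(i < n) a 0 i *: ((i.+1%:R - 1) *: idd_e i.+1).

Fact idd_phi_fun_is_linear : linear idd_phi_fun.
Proof.
move=> c a b; rewrite /idd_phi_fun scaler_sumr -big_split /=.
by apply: eq_bigr => i _; rewrite !mxE scalerDl -scalerA.
Qed.

HB.instance Definition _ :=
  GRing.isLinear.Build R[i] IDD IDD *:%R idd_phi_fun idd_phi_fun_is_linear.

Definition idd_phi : 'End(IDD) := linfun idd_phi_fun.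

Lemma idd_eE (i : 'I_n) : idd_e i.+1 = delta_mx 0 i.
Proof. by apply/rowP => j; rewrite !mxE eqSS. Qed.

Lemma idd_mulE (i j : nat) : (1 <= i <= n)%N -> (1 <= j <= n)%N ->
  idd_mul (idd_e i) (idd_e j) =
    if (i + j <= n.+1)%N then i%:R *: idd_e (i + j - 1) else 0.
Proof.
case: i j => // i [] // j /= ltin ltjn.
rewrite /idd_mul (bigD1 (Ordinal ltin)) //= (bigD1 (Ordinal ltjn)) //=.
rewrite !mxE !eqxx mulr1 scale1r !big1 ?addr0 //.
- move=> i' /negPf; rewrite -val_eqE /= => nei.
  by apply: big1 => j' _; rewrite !mxE eqSS nei mul0r scale0r.
- move=> j' /negPf; rewrite -val_eqE /= => nej.
  by rewrite !mxE eqSS nej mulr0 scale0r.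
Qed.

Lemma idd_phiE (i : nat) : (1 <= i <= n)%N ->
  idd_phi (idd_e i) = (i%:R - 1) *: idd_e i.
Proof.
case: i => // i /= ltin; rewrite lfunE /= /idd_phi_fun.
rewrite (bigD1 (Ordinal ltin)) //= mxE eqxx scale1r big1 ?addr0 //.
move=> i' /negPf; rewrite -val_eqE /= => nei.
by rewrite mxE eqSS nei scale0r.
Qed.

Lemma idd_mul_linearl (b : IDD) : linear (idd_mul^~ b).
Proof.
move=> c a a'; rewrite /idd_mul scaler_sumr -big_split /=.
apply: eq_bigr => i _; rewrite scaler_sumr -big_split /=.
by apply: eq_bigr => j _; rewrite !mxE mulrDl scalerDl scalerA mulrA.
Qed.

Lemma idd_mul_linearr (a : IDD) : linear (idd_mul a).
Proof.
move=> c b b'; rewrite /idd_mul scaler_sumr -big_split /=.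
apply: eq_bigr => i _; rewrite scaler_sumr -big_split /=.
by apply: eq_bigr => j _; rewrite !mxE mulrDr scalerDl scalerA mulrCA.
Qed.

End IDD.

(* Main.v *)
Require Import Defs.
From mathcomp Require Import all_boot all_order all_algebra.
From mathcomp Require Import complex.
From mathcomp Require Import boolp classical_sets reals.
From mathcomp Require Import zify ring.

(** The product respects the grading in which [e_k] has degree [k - 1], and
    [phi] multiplies a homogeneous element by its degree; so every multiple
    of [phi] is a derivation ([derivation_scale_phi]).

    Conversely, [e_1] is a left unit, while right multiplication by [e_1] is
    diagonal with the distinct eigenvalues [1, ..., n] on [e_1, ..., e_n].
    The first fact, applied to [e_1 * e_1 = e_1], gives [D e_1 * e_1 = 0] for
    a derivation [D], and [0] is not an eigenvalue, so [D e_1 = 0]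
    ([derivation_e1]).  Hence [D] commutes with right multiplication by [e_1],
    and preserves each of its eigenlines: [D e_k] is a multiple [c_k] of [e_k]
    ([derivation_diag]).  Finally [e_2 * e_k = 2 e_(k+1)] forces
    [c_(k+1) = c_2 + c_k], and as [c_1 = 0] this says [c_k = (k - 1) c_2],
    i.e. [D = c_2 phi] ([derivation_eigenvalue]). *)

Set Implicit Arguments.
Unset Strict Implicit.
Unset Printing Implicit Defensive.

Import GRing.Theory Num.Theory.
Local Open Scope ring_scope.

Section DerivationsOfIDD.
Variables (R : realType) (n : nat).
Local Notation C := R[i].
Local Notation IDD := 'rV[C]_n.
Local Notation e := (@idd_e R n).
Local Notation mul := (@idd_mul R n).
Local Notation phi := (idd_phi R n).

Lemma idd_sum_e (a : IDD) : a = \sum_(i < n) a 0 i *: e i.+1.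
Proof.
by rewrite [LHS]row_sum_delta; apply: eq_bigr => i _; rewrite idd_eE.
Qed.

Lemma idd_mulr0 (a : IDD) : mul a 0 = 0.
Proof.
rewrite /idd_mul big1 // => i _; rewrite big1 // => j _.
by rewrite mxE mulr0 scale0r.
Qed.

Lemma idd_mulZl c (a b : IDD) : mul (c *: a) b = c *: mul a b.
Proof.
rewrite /idd_mul scaler_sumr; apply: eq_bigr => i _.
by rewrite scaler_sumr; apply: eq_bigr => j _; rewrite mxE scalerA mulrA.
Qed.

Lemma idd_mulZr c (a b : IDD) : mul a (c *: b) = c *: mul a b.
Proof.
rewrite /idd_mul scaler_sumr; apply: eq_bigr => i _.
by rewrite scaler_sumr; apply: eq_bigr => j _; rewrite mxE scalerA mulrCA.
Qed.

Lemma idd_phi_coord (a : IDD) (i : 'I_n) : phi a 0 i = i%:R * a 0 i.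
Proof.
rewrite lfunE /= /idd_phi_fun summxE (bigD1 i) //= big1 ?addr0.
  by rewrite !mxE eqxx mulr1 mulrC -natr1 addrK.
by move=> j /negPf neji; rewrite !mxE eqSS eq_sym (inj_eq val_inj) neji !mulr0.
Qed.

(** This also holds for the products that vanish because their degree is too
    large. *)
Lemma idd_phi_mul_basis i j :
  phi (idd_mul_basis R n i.+1 j.+1) = (i + j)%:R *: idd_mul_basis R n i.+1 j.+1.
Proof.
rewrite /idd_mul_basis; case: ifP => [leij|_]; last by rewrite linear0 scaler0.
rewrite linearZ /= idd_phiE; last by lia.
rewrite !scalerA mulrC; congr (_ * _ *: _).
by rewrite addSn addnS subn1 /= -natr1 addrK.
Qed.

Lemma derivation_scale_phi (c : C) : derivation mul (c *: phi).
Proof.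
move=> a b; rewrite !scale_lfunE idd_mulZl idd_mulZr -scalerDr; congr (_ *: _).
rewrite /idd_mul linear_sum -big_split; apply: eq_bigr => i _ /=.
rewrite linear_sum -big_split; apply: eq_bigr => j _ /=.
rewrite linearZ /= idd_phi_mul_basis !idd_phi_coord scalerA -scalerDl.
by congr (_ *: _); rewrite natrD; ring.
Qed.

Hypothesis n_gt0 : (0 < n)%N.

Lemma idd_mul_e1_coord (a : IDD) (i : 'I_n) :
  mul a (e 1) 0 i = i.+1%:R * a 0 i.
Proof.
have -> : mul a (e 1) = \sum_(j < n) (a 0 j * j.+1%:R) *: e j.+1.
  apply: eq_bigr => j _; rewrite (bigD1 (Ordinal n_gt0)) //= big1 ?addr0.
    rewrite mxE eqxx mulr1 /idd_mul_basis addn1 ltnS ltn_ord.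
    by rewrite scalerA subn1.
  move=> k; rewrite -val_eqE /= => nek.
  by rewrite mxE eqSS (negPf nek) mulr0 scale0r.
rewrite summxE (bigD1 i) //= big1 ?addr0; first by rewrite !mxE eqxx mulr1 mulrC.
by move=> j /negPf neji; rewrite !mxE eqSS eq_sym (inj_eq val_inj) neji mulr0.
Qed.

Lemma idd_mul1l (a : IDD) : mul (e 1) a = a.
Proof.
rewrite [RHS]idd_sum_e /idd_mul (bigD1 (Ordinal n_gt0)) //=.
rewrite [X in _ + X]big1 ?addr0 => [|k]; last first.
  rewrite -val_eqE /= => nek; rewrite big1 // => j _.
  by rewrite mxE eqSS (negPf nek) mul0r scale0r.
apply: eq_bigr => j _; rewrite mxE eqxx mul1r /idd_mul_basis.
by rewrite add1n !ltnS ltn_ord subn1 scale1r.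
Qed.

(** The eigenvalues of right multiplication by [e_1] are simple.  For [k] out of
    the range [1, ..., n] this says that [a = 0], because then [e k = 0]. *)
Lemma idd_mul_e1_eigen (k : nat) (a : IDD) :
  mul a (e 1) = k%:R *: a -> exists c, a = c *: e k.
Proof.
move=> eig.
have a0 (i : 'I_n) : i.+1 != k -> a 0 i = 0.
  move=> neik; have /rowP/(_ i) := eig.
  rewrite idd_mul_e1_coord mxE => /eqP.
  rewrite -subr_eq0 -mulrBl mulf_eq0 subr_eq0 eqr_nat (negPf neik).
  by move=> /eqP.
have [i /eqP eik|noi] := pickP (fun i : 'I_n => i.+1 == k).
  exists (a 0 i); apply/rowP => j; rewrite !mxE -eik eqSS.
  have [->|neji] := eqVneq j i; first by rewrite eqxx mulr1.
  by rewrite (inj_eq val_inj) (negPf neji) mulr0 a0 // -eik eqSS.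
exists 0; apply/rowP => j; rewrite !mxE mul0r a0 //.
by rewrite noi.
Qed.

Section OneDerivation.
Variables (D : 'End(IDD)) (derD : derivation mul D).

Lemma derivation_e1 : D (e 1) = 0.
Proof.
have := derD (e 1) (e 1); rewrite !idd_mul1l => /eqP.
rewrite -subr_eq subrr eq_sym => /eqP/rowP De1.
apply/rowP => i; have /eqP := De1 i.
by rewrite idd_mul_e1_coord !mxE mulf_eq0 pnatr_eq0 => /eqP.
Qed.

Lemma derivation_diag k : exists c, D (e k) = c *: e k.
Proof.
apply: idd_mul_e1_eigen.
have := derD (e k) (e 1); rewrite derivation_e1 idd_mulr0 addr0 => <-.
rewrite -linearZ; congr (D _); apply/rowP => i.
rewrite idd_mul_e1_coord !mxE.
by have [->|] := eqVneq i.+1 k; rewrite ?mulr0.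
Qed.

Lemma derivation_eigenvalue c k : D (e 2) = c *: e 2 -> (k < n)%N ->
  D (e k.+1) = (c * k%:R) *: e k.+1.
Proof.
move=> De2; elim: k => [_|k IHk ltkn].
  by rewrite derivation_e1 mulr0 scale0r.
have mul2 : mul (e 2) (e k.+1) = 2%:R *: e k.+2.
  rewrite idd_mulE; [|by lia..].
  by rewrite !addSn add0n !ltnS ltkn subn1.
have := derD (e 2) (e k.+1).
rewrite De2 (IHk (ltnW ltkn)) idd_mulZl idd_mulZr mul2 linearZ /=.
rewrite !scalerA -scalerDl => De.
have two_neq0 : 2%:R != 0 :> C by rewrite pnatr_eq0.
apply: (scalerI two_neq0); rewrite De scalerA -[k.+1%:R]natr1.
by congr (_ *: _); ring.
Qed.

Lemma derivation_in_line_phi : D \in <[phi]>%VS.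
Proof.
have [c De2] := derivation_diag 2; apply/vlineP; exists c.
apply/lfunP => a; rewrite [a]idd_sum_e !linear_sum; apply: eq_bigr => i _ /=.
rewrite !linearZ /= scale_lfunE (derivation_eigenvalue De2) // idd_phiE ?ltn_ord //.
by rewrite !scalerA -[i.+1%:R]natr1 addrK mulrA.
Qed.

End OneDerivation.
End DerivationsOfIDD.

Unset Implicit Arguments.

Theorem theorem3p3 (R : realType) (n : nat) (n_ge1 : (1 <= n)%N) :
  Der (@idd_mul R n) = [set D | D \in <[idd_phi R n]>%VS]%classic.
Proof.
apply/seteqP; split=> D /=; first exact: derivation_in_line_phi.
by move=> /vlineP[c ->]; exact: derivation_scale_phi.
Qed.
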